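(* Let $s=2$. The coefficients of an explicit $2$-stage stochastic Runge-Kutta (SRK) method satisfy conditions 1.--10. listed in the context (the order one conditions 1.--9. together with the deterministic order two condition 10.; i.e. the method has order $(p_D,p_S)=(2,1)$) if and only if there exist $c_1\in\{-1,1\}$ and $c_2,\dots,c_{17}\in\mathbb{R}$ with $$c_2\ne0,\quad c_4c_{17}=0,\quad c_6(c_{13}+c_{14}-c_{15}-c_{16})=0,$$ $$c_7(c_9+c_{10}-c_{11}-c_{12})=0,\quad c_7\big((c_{13}+c_{14})^2-(c_{15}+c_{16})^2\big)=0$$ such that $$\alpha^T=\begin{bmatrix}1-\frac1{2c_2}&\frac1{2c_2}\end{bmatrix},\quad {\beta^{(1)}}^T=\begin{bmatrix}c_1-c_4&c_4\end{bmatrix},\quad {\beta^{(2)}}^T=\begin{bmatrix}c_5&-c_5\end{bmatrix},$$ $${\beta^{(3)}}^T=\begin{bmatrix}c_6&-c_6\end{bmatrix},\quad {\beta^{(4)}}^T=\begin{bmatrix}c_7&-c_7\end{bmatrix},$$ $$A^{(0)}=\begin{bmatrix}0&0\\c_2&0\end{bmatrix},\quad A^{(1)}=\begin{bmatrix}0&0\\c_8&0\end{bmatrix},\quad A^{(2)}=\begin{bmatrix}c_9&c_{10}\\c_{11}&c_{12}\end{bmatrix},$$ $$B^{(0)}=\begin{bmatrix}0&0\\c_3&0\end{bmatrix},\quad B^{(1)}=\begin{bmatrix}0&0\\c_{17}&0\end{bmatrix},\quad B^{(2)}=\begin{bmatrix}c_{13}&c_{14}\\c_{15}&c_{16}\e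nd{bmatrix}.$$
   Context: The coefficients of an explicit $s$-stage SRK method (for the weak approximation of It\^o SDEs) are vectors $\alpha,\beta^{(1)},\beta^{(2)},\beta^{(3)},\beta^{(4)}\in\mathbb{R}^s$ and matrices $A^{(q)},B^{(q)}\in\mathbb{R}^{s\times s}$, $q=0,1,2$, where $A^{(q)}_{ij}=B^{(q)}_{ij}=0$ for $j\ge i$ and $q\in\{0,1\}$; no restriction is imposed on $A^{(2)}$, $B^{(2)}$. Let $e=(1,\dots,1)^T\in\mathbb{R}^s$. Powers and products of vectors are component-wise. $p_S$ denotes the weak order for SDEs and $p_D$ the order when the method is applied to an ODE (zero diffusion), in which case it reduces to the Runge-Kutta method with matrix $A^{(0)}$ and weights $\alpha$. Conditions: 1. $\alpha^Te=1$; 2. ${\beta^{(4)}}^Te=0$; 3. ${\beta^{(3)}}^Te=0$; 4. $({\beta^{(1)}}^Te)^2=1$; 5. ${\beta^{(2)}}^Te=0$; 6. ${\beta^{(1)}}^TB^{(1)}e=0$; 7. ${\beta^{(4)}}^TA^{(2)}e=0$; 8. ${\beta^{(3)}}^TB^{(2)}e=0$; 9. ${\beta^{(4)}}^T(B^{(2)}e)^2=0$; 10. $\alpha^TA^{(0)}e=\frac12$. *)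

(* Defs.v *)
From mathcomp Require Import all_boot all_order all_algebra.
From mathcomp Require Import reals.
Set Implicit Arguments.
Unset Strict Implicit.
Unset Printing Implicit Defensive.
Import GRing.Theory.
Local Open Scope ring_scope.

Record srk (R : realType) (s : nat) := SRK {
  alpha : 'cV[R]_s;
  beta1 : 'cV[R]_s;
  beta2 : 'cV[R]_s;
  beta3 : 'cV[R]_s;
  beta4 : 'cV[R]_s;
  A0 : 'M[R]_s;
  A1 : 'M[R]_s;
  A2 : 'M[R]_s;
  B0 : 'M[R]_s;
  B1 : 'M[R]_s;
  B2 : 'M[R]_s
}.

Definition strictly_lower (R : realType) (s : nat) (M : 'M[R]_s) : Prop :=
  forall i j : 'I_s, (i <= j)%N -> M i j = 0.

(* A2 and B2 are deliberately unrestricted. *)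
Definition explicit_srk (R : realType) (s : nat) (m : srk R s) : Prop :=
  [/\ strictly_lower (A0 m), strictly_lower (A1 m),
      strictly_lower (B0 m) & strictly_lower (B1 m)].

Definition ones (R : realType) (s : nat) : 'cV[R]_s := const_mx 1.

Definition dot (R : realType) (s : nat) (u v : 'cV[R]_s) : R :=
  (u^T *m v) 0 0.

Definition sqr_cw (R : realType) (s : nat) (v : 'cV[R]_s) : 'cV[R]_s :=
  map_mx (fun x => x ^+ 2) v.

Record order_one_conditions (R : realType) (s : nat) (m : srk R s) : Prop := {
  cond1 : dot (alpha m) (ones R s) = 1;
  cond2 : dot (beta4 m) (ones R s) = 0;
  cond3 : dot (beta3 m) (ones R s) = 0;
  cond4 : dot (beta1 m) (ones R s) ^+ 2 = 1;
  cond5 : dot (beta2 m) (ones R s) = 0;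
  cond6 : dot (beta1 m) (B1 m *m ones R s) = 0;
  cond7 : dot (beta4 m) (A2 m *m ones R s) = 0;
  cond8 : dot (beta3 m) (B2 m *m ones R s) = 0;
  cond9 : dot (beta4 m) (sqr_cw (B2 m *m ones R s)) = 0
}.

Definition det_order_two_condition (R : realType) (s : nat) (m : srk R s) :
    Prop :=
  dot (alpha m) (A0 m *m ones R s) = 1 / 2.

Definition row2 (R : realType) (a b : R) : 'rV[R]_2 :=
  \row_(j < 2) nth 0 [:: a; b] j.

Definition mx2 (R : realType) (a b c d : R) : 'M[R]_2 :=
  \matrix_(i < 2, j < 2) nth 0 (nth [::] [:: [:: a; b]; [:: c; d]] i) j.

(* Main.v *)
Require Import Defs.
From mathcomp Require Import all_boot all_order all_algebra.
From mathcomp Require Import reals ring lra.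
Import GRing.Theory.
Local Open Scope ring_scope.

(** For two stages every condition is a scalar polynomial equation in the entries ([dot2E],
    [mulmx_ones2E]), and explicitness leaves [A0], [A1], [B0], [B1] one free entry each. Conditions
    2, 3 and 5 make [beta4], [beta3], [beta2] multiples of (1, -1), so 7, 8 and 9 become a scalar
    times a difference of row sums or of their squares. Condition 10 reads
    [alpha m 1 0 * A0 m 1 0 = 1 / 2], which forces [c2 <> 0] and, with condition 1, determines
    [alpha]. Condition 4 says that the entries of [beta1] sum to a sign. The parameters are thus the
    remaining free entries, and each step can be reversed. *)

Lemma ord2_eq (i : 'I_2) : i = 0 \/ i = 1.
Proof. by case: i => [[|[|]]] // ?; [left | right]; apply: val_inj. Qed.

Lemma sum_ord2 (V : nmodType) (F : 'I_2 -> V) : \sum_i F i = F 0 + F 1.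
Proof. by rewrite big_ord_recl big_ord1; congr (_ + F _); apply: val_inj. Qed.

(** Stated as an equivalence, like [mx2P], so that one rewrite reduces the parametrization to scalar
    equations, whether it is the goal or a hypothesis. *)
Lemma trmx_row2P (R : realType) (u : 'cV[R]_2) (a b : R) :
  u^T = row2 a b <-> u 0 0 = a /\ u 1 0 = b.
Proof.
split=> [/matrixP e|[<- <-]]; first by
  have := (e 0 0, e 0 1); rewrite !mxE => -[].
by apply/rowP=> j; rewrite !mxE; case: (ord2_eq j) => ->.
Qed.

Lemma mx2P (R : realType) (M : 'M[R]_2) (a b c d : R) :
  M = mx2 a b c d <-> [/\ M 0 0 = a, M 0 1 = b, M 1 0 = c & M 1 1 = d].
Proof.
split=> [->|[<- <- <- <-]]; first by rewrite !mxE.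
apply/matrixP=> i j; rewrite !mxE.
by case: (ord2_eq i) => ->; case: (ord2_eq j) => ->.
Qed.

Lemma dot2E (R : realType) (u v : 'cV[R]_2) :
  dot u v = u 0 0 * v 0 0 + u 1 0 * v 1 0.
Proof. by rewrite /dot mxE sum_ord2 !mxE. Qed.

Lemma mulmx_ones2E (R : realType) (M : 'M[R]_2) (i : 'I_2) :
  (M *m ones R 2) i 0 = M i 0 + M i 1.
Proof. by rewrite mxE sum_ord2 !mxE !mulr1. Qed.

Lemma strictly_lower2P (R : realType) (M : 'M[R]_2) :
  strictly_lower M -> [/\ M 0 0 = 0, M 0 1 = 0 & M 1 1 = 0].
Proof. by move=> lowM; rewrite !lowM. Qed.

Theorem mainTheorem2 (R : realType) (m : srk R 2) (hm : explicit_srk m) :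
  order_one_conditions m /\ det_order_two_condition m <->
  exists c1 c2 c3 c4 c5 c6 c7 c8 c9 c10 c11 c12 c13 c14 c15 c16 c17 : R,
    (c1 = -1 \/ c1 = 1) /\
    c2 <> 0 /\
    c4 * c17 = 0 /\
    c6 * (c13 + c14 - c15 - c16) = 0 /\
    c7 * (c9 + c10 - c11 - c12) = 0 /\
    c7 * ((c13 + c14) ^+ 2 - (c15 + c16) ^+ 2) = 0 /\
    (alpha m)^T = row2 (1 - 1 / (2 * c2)) (1 / (2 * c2)) /\
    (beta1 m)^T = row2 (c1 - c4) c4 /\
    (beta2 m)^T = row2 c5 (- c5) /\
    (beta3 m)^T = row2 c6 (- c6) /\
    (beta4 m)^T = row2 c7 (- c7) /\
    A0 m = mx2 0 0 c2 0 /\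
    A1 m = mx2 0 0 c8 0 /\
    A2 m = mx2 c9 c10 c11 c12 /\
    B0 m = mx2 0 0 c3 0 /\
    B1 m = mx2 0 0 c17 0 /\
    B2 m = mx2 c13 c14 c15 c16.

Proof.
case: hm => /strictly_lower2P[a00 a01 a11] /strictly_lower2P[a00' a01' a11'].
move=> /strictly_lower2P[b00 b01 b11] /strictly_lower2P[b00' b01' b11'].
split.
  case=> -[]; rewrite /det_order_two_condition !dot2E ![sqr_cw _ _ _]mxE.
  rewrite !mulmx_ones2E ![ones _ _ _ _]mxE !mulr1.
  rewrite a00 a01 a11 b00' b01' b11' !(addr0, mulr0, add0r).
  move=> h1 h2 h3 /eqP h4 h5 h6 h7 h8 h9 h10.
  (* If this entry vanished, condition 10 would read 0 = 1/2. *)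
  have c2_neq0 : A0 m 1 0 <> 0 by move=> c20; move: h10; rewrite c20; lra.
  have alpha1 : alpha m 1 0 = 1 / (2 * A0 m 1 0).
    by apply: (mulIf (introN eqP c2_neq0)); rewrite h10; field; apply/eqP.
  have e2 : beta2 m 1 0 = - beta2 m 0 0 by lra.
  have e3 : beta3 m 1 0 = - beta3 m 0 0 by lra.
  have e4 : beta4 m 1 0 = - beta4 m 0 0 by lra.
  (* Only [c1] is not an entry: it is the sum whose square condition 4 sets to 1. *)
  exists (beta1 m 0 0 + beta1 m 1 0), (A0 m 1 0), (B0 m 1 0), (beta1 m 1 0).
  exists (beta2 m 0 0), (beta3 m 0 0), (beta4 m 0 0), (A1 m 1 0).
  exists (A2 m 0 0), (A2 m 0 1), (A2 m 1 0), (A2 m 1 1).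
  exists (B2 m 0 0), (B2 m 0 1), (B2 m 1 0), (B2 m 1 1), (B1 m 1 0).
  (* Substituting [e3] and [e4] lets the first weight factor out of conditions 7, 8 and 9. *)
  rewrite !trmx_row2P !mx2P; move: h7 h8 h9; rewrite e3 e4 => h7 h8 h9.
  do ![split=> //].
  - by move: h4; rewrite sqrf_eq1 => /orP[]/eqP->; [right|left].
  - by rewrite -h8; ring.
  - by rewrite -h7; ring.
  - by rewrite -h9; ring.
  - by rewrite -alpha1; lra.
  - by ring.
move=> [c1 [c2 [c3 [c4 [c5 [c6 [c7 [c8 [c9
  [c10 [c11 [c12 [c13 [c14 [c15 [c16 [c17]]]]]]]]]]]]]]]]].
rewrite !trmx_row2P !mx2P.
(* The constraints are named after the conditions they yield. *)
move=> [c1E [/eqP c2_neq0 [h6 [h8 [h7 [h9]]]]]].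
move=> [[u0 u1] [[v0 v1] [[w0 w1] [[x0 x1] [[y0 y1]]]]]].
move=> [[_ _ p10 _] [_ [[q00 q01 q10 q11] [_ [[_ _ r10 _] [s00 s01 s10 s11]]]]]].
split; first split; rewrite /det_order_two_condition !dot2E ?[sqr_cw _ _ _]mxE;
  rewrite ?mulmx_ones2E ?[ones _ _ _ _]mxE ?mulr1;
  rewrite ?(u0, u1, v0, v1, w0, w1, x0, x1, y0, y1);
  rewrite ?(q00, q01, q10, q11, s00, s01, s10, s11, p10, r10);
  rewrite ?(a00, a01, a11, b00', b01', b11').
- by rewrite subrK.
- by rewrite subrr.
- by rewrite subrr.
- by rewrite subrK; case: c1E => ->; rewrite ?sqrrN expr1n.
- by rewrite subrr.
- by rewrite !addr0 mulr0 add0r.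
- by rewrite -h7; ring.
- by rewrite -h8; ring.
- by rewrite -h9; ring.
(* Condition 10: [c2] cancels in [1 / (2 * c2) * c2] thanks to [c2_neq0]. *)
- by field.
Qed.
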